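(* Let $\lambda\in W\Lambda$ and $\alpha,\beta$ positive roots such that both $(\lambda,\lambda^\alpha)$ and $(\lambda^\alpha,\lambda^{\alpha,\beta})$ are admissible, where $\lambda^{\alpha,\beta}=(\lambda^\alpha)^\beta$. (i) If $(\alpha,\beta)=2$, then $\alpha=\beta$ and it is a simple root. (ii) Otherwise, there exist positive roots $\alpha'\ne\alpha$ and $\beta'$ such that $(\lambda,\lambda^{\alpha'})$ and $(\lambda^{\alpha'},\lambda^{\alpha',\beta'})$ are admissible and $\lambda^{\alpha,\beta}=\lambda^{\alpha',\beta'}$; the pair $(\alpha',\beta')$ is uniquely determined by these conditions.
   Context: Fix integers $n\ge2$, $r\ge n+2$. Let $\varepsilon_1,\dots,\varepsilon_n$ be an orthonormal basis of $\mathbb R^n$ (inner product $(\cdot,\cdot)$), $\bar\varepsilon_i=\varepsilon_i-\frac1n\sum_j\varepsilon_j$, $P=\sum_i\mathbb Z\bar\varepsilon_i$, simple roots $\alpha_i=\varepsilon_i-\varepsilon_{i+1}$ ($1\le i\le n-1$), $Q=\sum_i\mathbb Z\alpha_i$, $\theta=\alpha_1+\dots+\alpha_{n-1}$, positive roots $\varepsilon_i-\varepsilon_j$ ($i<j$). Fix $\Lambda\in P$ with $(\Lambda,\alpha_i)>0$ for all $i$ and $(\Lambda,\theta)<r$. $S_n$ acts by permuting the $\varepsilon_i$; $\ell(\sigma)$ is the length of $\sigma$. Each element of $W\Lambda=\{\sigma\Lambda+r\gamma:\sigma\in S_n,\gamma\in Q\}$ is uniquely written $\lambda=\sigma\Lambda+r\gamma$,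 and $\deg\lambda=\ell(\sigma)-2|\gamma|$, where $|\sum c_i\alpha_i|=\sum c_i$. For a positive root $\alpha$, $m_\alpha(\lambda)$ is the integer with $0<m_\alpha(\lambda)<r$, $m_\alpha(\lambda)\equiv(\lambda,\alpha)\bmod r$, and $\lambda^\alpha=\lambda-m_\alpha(\lambda)\alpha\in W\Lambda$. The pair $(\lambda,\lambda^\alpha)$ is called admissible if $\deg\lambda^\alpha=\deg\lambda+1$. *)

(* Defs.v *)
(* Vectors of R^n are represented by rational row vectors
   'rV[rat]_n: every object in the statement (P, Q, W Lambda, roots) lies in
   Q^n, and the inner product is the standard one. *)
From HB Require Import structures.
From mathcomp Require Import all_boot all_order fingroup perm all_algebra.
Set Implicit Arguments. Unset Strict Implicit. Unset Printing Implicit Defensive.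
Import Order.TTheory GRing.Theory Num.Theory.
Local Open Scope ring_scope.

Section Defs.
Variable n : nat.

Definition eps (i : 'I_n) : 'rV[rat]_n := \row_k ((k == i)%:R).

Definition epsbar (i : 'I_n) : 'rV[rat]_n :=
  eps i - (n%:R)^-1 *: \sum_(j < n) eps j.

Definition dot (u v : 'rV[rat]_n) : rat := \sum_(k < n) u 0 k * v 0 k.

Definition inP (v : 'rV[rat]_n) : Prop :=
  exists c : 'I_n -> int, v = \sum_(i < n) (c i)%:~R *: epsbar i.

(* simple root alpha_i = eps_i - eps_{i+1}, indexed here by i = 0 .. n-2 *)
Definition alpha (i : nat) : 'rV[rat]_n :=
  \row_k (((k : nat) == i)%:R - ((k : nat) == i.+1)%:R).

Definition theta : 'rV[rat]_n := \sum_(i < n.-1) alpha i.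

Definition posroot (a : 'rV[rat]_n) : Prop :=
  exists i j : 'I_n, (i < j)%N /\ a = eps i - eps j.

Definition simple_root (a : 'rV[rat]_n) : Prop :=
  exists i : nat, (i.+1 < n)%N /\ a = alpha i.

(* S_n permutes the eps_i : s (eps_i) = eps_(s i) *)
Definition permact (s : 'S_n) (v : 'rV[rat]_n) : 'rV[rat]_n :=
  \row_k v 0 ((s^-1)%g k).

Definition perm_length (s : 'S_n) : nat :=
  #|[set p : 'I_n * 'I_n | (p.1 < p.2)%N && (s p.2 < s p.1)%N]|.

Definition Qelt (c : nat -> int) : 'rV[rat]_n :=
  \sum_(i < n.-1) (c i)%:~R *: alpha i.

Definition Qheight (c : nat -> int) : int := \sum_(i < n.-1) c i.

Variables (r : nat) (Lam : 'rV[rat]_n).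

Definition inWL (lam : 'rV[rat]_n) : Prop :=
  exists (s : 'S_n) (c : nat -> int), lam = permact s Lam + r%:R *: Qelt c.

(* deg lam = d, where lam = s Lam + r gamma (this decomposition is unique
   under the standing hypotheses) and d = l(s) - 2|gamma| *)
Definition has_deg (lam : 'rV[rat]_n) (d : int) : Prop :=
  exists (s : 'S_n) (c : nat -> int),
    lam = permact s Lam + r%:R *: Qelt c /\
    d = (perm_length s)%:Z - 2 * Qheight c.

(* m_alpha(lam): the representative in [0, r) of (lam, alpha) mod r
   (it lies in (0, r) for lam in W Lambda) *)
Definition malpha (lam a : 'rV[rat]_n) : rat :=
  dot lam a - r%:R * (Num.floor (dot lam a / r%:R))%:~R.

Definition refl (lam a : 'rV[rat]_n) : 'rV[rat]_n := lam - malpha lam a *: a.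

Definition admissible (lam a : 'rV[rat]_n) : Prop :=
  exists d : int, has_deg lam d /\ has_deg (refl lam a) (d + 1).

End Defs.

(* Main.v *)
(* For [lam = s Lam + r gamma] the degree is the sum over positions [a < b] of
   [- floor ((lam_a - lam_b) / r)].  A reflection in [eps_i - eps_j] replaces
   [(lam_i, lam_j)] by [(lam_j + r f, lam_i - r f)], [f = floor ((lam_i - lam_j) / r)],
   and raises this sum by 1 plus twice the number of [k] strictly between [i] and [j]
   with [floor_ij = floor_ik + floor_kj].  So every step raises the degree by at least 1,
   and once one two-step path between two points is admissible, every two-step path
   between them is.  Reducing mod [r], a two-step path factors a fixed permutation into
   two transpositions.  For disjoint transpositions there are two factorizations, which
   differ by order; for a 3-cycle on positions [p < q < s] there are three, of which two
   have the same target and the third contains an inadmissible reflection in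
   [eps_p - eps_s]. *)
Require Import Defs.
From HB Require Import structures.
From mathcomp Require Import all_boot all_order fingroup perm all_algebra.
From mathcomp Require Import zify ring lra.
Set Implicit Arguments. Unset Strict Implicit. Unset Printing Implicit Defensive.
Import Order.TTheory GRing.Theory Num.Theory.
Local Open Scope ring_scope.

(** * Factorizations of a permutation into two transpositions *)

Section TranspositionFactorizations.
Local Open Scope nat_scope.
Variable n : nat.
Implicit Types i j k l p q s x : 'I_n.

(** Applying [tperm i j] shows that both transpositions send [x] to the same point; if that point is
    not [x], the two ordered pairs coincide. So a product of two distinct transpositions moves all
    of their indices, and any factorization has its indices in the support of the product. *)
Lemma tperm_mul_fix i j k l x : i < j -> k < l -> (i, j) != (k, l) ->
  tperm i j (tperm k l x) = x -> x \notin [:: i; j; k; l].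
Proof.
move=> ij kl ne /(congr1 (tperm i j)); rewrite tpermK => e.
apply: contraNN ne; rewrite !inE xpair_eqE.
move: e; case: tpermP => [->|->|/eqP xk /eqP xl]; case: tpermP => [xi|xj|/eqP xi /eqP xj];
  move=> ?; subst; rewrite ?eqxx //= ?(negbTE xk, negbTE xl, negbTE xi, negbTE xj) //= => _.
all: try by move: ij kl; rewrite ?ltnn //; lia.
Qed.

Lemma tperm_mul_cycle p q s i j k l :
  p < q -> q < s -> i < j -> k < l ->
  (forall x, tperm p q (tperm q s x) = tperm i j (tperm k l x)) ->
  [\/ [/\ i = p, j = q, k = q & l = s], [/\ i = q, j = s, k = p & l = s]
    | [/\ i = p, j = s, k = p & l = q]].
Proof.
move=> pq qs ij kl H.
have pq' : (p == q) = false by apply: ltn_eqF.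
have qs' : (q == s) = false by apply: ltn_eqF.
have ps' : (p == s) = false by apply/ltn_eqF/(ltn_trans pq).
have E := (pq', qs', ps', etrans (eq_sym _ _) pq', etrans (eq_sym _ _) qs',
  etrans (eq_sym _ _) ps').
have ne : (i, j) != (k, l).
  apply/eqP => -[ik jl]; move: (H p).
  by rewrite ik jl tpermK !permE /= !E eqxx => /eqP; rewrite E.
have {}H x : (if x == p then q else if x == q then s else if x == s then p else x)
    = tperm i j (tperm k l x).
  rewrite -H !permE /=; do ![case: eqP => // ?; subst; rewrite ?E ?eqxx //].
have mem x : x \in [:: i; j; k; l] -> [|| x == p, x == q | x == s].
  apply: contraLR => /norP[xp /norP[xq xs]].
  apply: (tperm_mul_fix ij kl ne).
  by rewrite -H (negbTE xp) (negbTE xq) (negbTE xs).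
move: (H p) (H q); rewrite !permE /= !E !eqxx.
move: (mem i) (mem j) (mem k) (mem l); rewrite !inE !eqxx !orbT.
move=> /(_ isT) + /(_ isT) + /(_ isT) + /(_ isT).
(* The memberships leave 81 index tuples; the orders [i < j], [k < l] and the images of [p] and [q]
   under the cycle eliminate all but three. *)
do 4 (case/or3P => /eqP ?); subst; try lia; rewrite ?E ?eqxx /= ?E ?eqxx.
all: move=> /eqP + /eqP; rewrite ?E ?eqxx //.
all: by [constructor 1|constructor 2|constructor 3].
Qed.

(** Inverting both sides swaps the factors and reduces this cycle to the opposite one. *)
Lemma tperm_mul_cycleV p q s i j k l :
  p < q -> q < s -> i < j -> k < l ->
  (forall x, tperm q s (tperm p q x) = tperm i j (tperm k l x)) ->
  [\/ [/\ i = q, j = s, k = p & l = q], [/\ i = p, j = s, k = q & l = s]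
    | [/\ i = p, j = q, k = p & l = s]].
Proof.
move=> pq qs ij kl H; case: (@tperm_mul_cycle p q s k l i j) => //.
- move=> x; apply: (can_inj (tpermK k l)); apply: (can_inj (tpermK i j)).
  by rewrite -H !tpermK.
- by case=> -> -> -> ->; constructor 1.
- by case=> -> -> -> ->; constructor 2.
- by case=> -> -> -> ->; constructor 3.
Qed.

Lemma tperm_mul_disjoint i j k l i' j' k' l' :
  i < j -> k < l -> i' < j' -> k' < l' ->
  i != k -> i != l -> j != k -> j != l ->
  (forall x, tperm i j (tperm k l x) = tperm i' j' (tperm k' l' x)) ->
  [/\ i' = i, j' = j, k' = k & l' = l] \/ [/\ i' = k, j' = l, k' = i & l' = j].
Proof.
move=> ij kl ij' kl' /negbTE ik /negbTE il /negbTE jk /negbTE jl H.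
have ijF : (i == j) = false by apply: ltn_eqF.
have klF : (k == l) = false by apply: ltn_eqF.
have E := (ik, il, jk, jl, ijF, klF).
have {}E := (E, etrans (eq_sym _ _) ik, etrans (eq_sym _ _) il, etrans (eq_sym _ _) jk,
  etrans (eq_sym _ _) jl, etrans (eq_sym _ _) ijF, etrans (eq_sym _ _) klF).
have ne : (i', j') != (k', l').
  apply/eqP => -[ik' jl']; move: (H i).
  by rewrite ik' jl' tpermK !permE /= !E eqxx => /eqP; rewrite E.
have {}H x : (if x == i then j else if x == j then i else
              if x == k then l else if x == l then k else x)
    = tperm i' j' (tperm k' l' x).
  rewrite -H !permE /=; do ![case: eqP => // ?; subst; rewrite ?E ?eqxx //].
have mem x : x \in [:: i'; j'; k'; l'] -> [|| x == i, x == j, x == k | x == l].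
  apply: contraLR => /norP[xi /norP[xj /norP[xk xl]]].
  apply: (tperm_mul_fix ij' kl' ne).
  by rewrite -H (negbTE xi) (negbTE xj) (negbTE xk) (negbTE xl).
move: (H i) (H k); rewrite !permE /= !E !eqxx.
move: (mem i') (mem j') (mem k') (mem l'); rewrite !inE !eqxx !orbT.
move=> /(_ isT) + /(_ isT) + /(_ isT) + /(_ isT).
have asym (x y : 'I_n) : x < y -> y < x -> False by move=> xy /(ltn_trans xy); rewrite ltnn.
(* Splitting [i'], [j'] first lets the order discard impossible pairs before [k'], [l'] are split,
   which avoids facing all 256 tuples at once. *)
do 2 (case/or4P => /eqP ?); subst i' j';
  try by [case: (asym _ _ ij')|case: (asym _ _ ij' kl)|case: (asym _ _ ij' ij)].
all: do 2 (case/or4P => /eqP ?); subst k' l';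
  try by [case: (asym _ _ kl')|case: (asym _ _ kl' kl)|case: (asym _ _ kl' ij)].
all: rewrite ?E ?eqxx /= ?E ?eqxx.
all: move=> /eqP + /eqP; rewrite ?E ?eqxx //.
all: by [left|right].
Qed.

End TranspositionFactorizations.

(** * Integer quotients by $r$ of rational numbers *)

Section FloorDivision.
Variable r : nat.
Hypothesis r_gt0 : (0 < r)%N.
Implicit Types (x y : rat) (e : int).

Definition fdiv x : int := Num.floor (x / r%:R).

Let rR_gt0 : 0 < r%:R :> rat. Proof. by rewrite ltr0n. Qed.
Let rR_neq0 : r%:R != 0 :> rat. Proof. by rewrite gt_eqF. Qed.

Lemma fdiv_eq x e : (fdiv x == e) = (r%:R * e%:~R <= x < r%:R * (e + 1)%:~R).
Proof. by rewrite /fdiv floor_eq ler_pdivlMr // ltr_pdivrMr // ![_ * r%:R]mulrC. Qed.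

Lemma fdiv_itv x : r%:R * (fdiv x)%:~R <= x < r%:R * (fdiv x + 1)%:~R.
Proof. by rewrite -fdiv_eq. Qed.

Lemma fdivDz x e : fdiv (x + r%:R * e%:~R) = fdiv x + e.
Proof. by rewrite /fdiv mulrDl mulrAC divff // mul1r floorDrz ?intrKfloor // intr_int. Qed.

Lemma fdivBz x e : fdiv (x - r%:R * e%:~R) = fdiv x - e.
Proof. by rewrite -mulrN -intrN fdivDz. Qed.

Lemma fdivN x : (forall e, x != r%:R * e%:~R) -> fdiv (- x) = - fdiv x - 1.
Proof.
move=> xr; apply/eqP; rewrite fdiv_eq addrNK.
have := fdiv_itv x; rewrite le_eqVlt eq_sym (negbTE (xr _)) /= => /andP[h1 h2].
rewrite -opprD !intrN !mulrN lerN2 ltrN2 h1 andbT; exact: ltW.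
Qed.

Lemma fdivD x y : fdiv x + fdiv y <= fdiv (x + y) <= fdiv x + fdiv y + 1.
Proof.
have /andP[x1 x2] := fdiv_itv x; have /andP[y1 y2] := fdiv_itv y.
have /andP[z1 z2] := fdiv_itv (x + y).
move: x1 x2 y1 y2 z1 z2; rewrite !intrD !mulrDr => x1 x2 y1 y2 z1 z2.
by apply/andP; split; rewrite -ltzD1 -(ltr_int rat) -(ltr_pM2l rR_gt0) !intrD !mulrDr; lra.
Qed.

End FloorDivision.

(** * Double sums supported on two rows and two columns *)

Section DoubleSum.
Variables (I : finType) (V : nmodType).

(** This isolates the effect on a sum over pairs of changing coordinates [i] and [j] only: a block
    for the two indices themselves, and one term for each further index [k]. *)
Lemma sum_cross (E : I -> I -> V) i j : i != j ->
  (forall a b, a != i -> a != j -> b != i -> b != j -> E a b = 0) ->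
  \sum_a \sum_b E a b =
  E i i + E i j + E j i + E j j +
  \sum_(k | (k != i) && (k != j)) (E k i + E k j + E i k + E j k).
Proof.
move=> ij E0.
have in2 a : \sum_b E a b = E a i + E a j + \sum_(k | (k != i) && (k != j)) E a k.
  by rewrite (bigD1 i) //= (bigD1 j) 1?eq_sym //= addrA.
rewrite (bigD1 i) //= [X in _ + X](bigD1 j) 1?eq_sym //= !in2.
rewrite [X in _ + (_ + X)](_ : _ =
  \sum_(k | (k != i) && (k != j)) (E k i + E k j)); last first.
  apply: eq_bigr => k /andP[ki kj]; rewrite in2 big1 ?addr0 // => b /andP[bi bj].
  exact: E0.
rewrite !big_split /= -[E i i + E i j + E j i + _]addrA.
by rewrite [LHS](AC (2*(2*(1*1))) ((1*3)*(5*6*2*4))).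
Qed.

End DoubleSum.

(** * The change of degree under a reflection *)

Section Reflection.
Variables (n r : nat).
Hypothesis r_gt0 : (0 < r)%N.
Implicit Types (lam : 'rV[rat]_n) (i j k l : 'I_n).
Local Notation root i j := (eps i - eps j).
Local Notation fd lam i j := (fdiv r (lam 0 i - lam 0 j)).

Lemma dot_root lam i j : dot lam (root i j) = lam 0 i - lam 0 j.
Proof.
rewrite /dot.
under eq_bigr do rewrite !mxE mulrBr.
have d1 l : \sum_k lam 0 k * (k == l)%:R = lam 0 l.
  rewrite (bigD1 l) //= eqxx mulr1 big1 ?addr0 // => k /negbTE ->.
  by rewrite mulr0.
by rewrite sumrB !d1.
Qed.

Lemma refl_rootE lam i j k : i != j -> refl r lam (root i j) 0 k =
  if k == i then lam 0 j + r%:R * (fd lam i j)%:~R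
  else if k == j then lam 0 i - r%:R * (fd lam i j)%:~R else lam 0 k.
Proof.
move=> ij; rewrite /refl /malpha !mxE dot_root -/(fdiv r _).
case: eqVneq => [->|ki].
  by rewrite (negbTE ij) /=; ring.
by case: eqVneq => [->|kj] /=; ring.
Qed.

Lemma refl_root_split lam i j : i != j -> let mu := refl r lam (root i j) in
  [/\ mu 0 i = lam 0 j + r%:R * (fd lam i j)%:~R,
      mu 0 j = lam 0 i - r%:R * (fd lam i j)%:~R
    & forall k, k != i -> k != j -> mu 0 k = lam 0 k].
Proof.
move=> ij; rewrite /= !refl_rootE // eqxx eq_sym (negbTE ij) eqxx; split=> // k.
by move=> /negbTE ki /negbTE kj; rewrite refl_rootE // ki kj.
Qed.

(** Geometrically, [lam] lies on none of the affine hyperplanes where a root takes a value in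
    $r\mathbb Z$. *)
Definition regular lam :=
  forall i j (e : int), i != j -> lam 0 i - lam 0 j != r%:R * e%:~R.

Lemma fdC lam i j : regular lam -> i != j -> fd lam j i = - fd lam i j - 1.
Proof. by move=> reg ij; rewrite -opprB fdivN // => e; apply: reg. Qed.

(** The degree read off from the coordinates alone, without choosing a decomposition into a
    permutation and a lattice part; [has_deg_floor_deg] links the two. *)
Definition floor_deg lam : int :=
  - \sum_(i < n) \sum_(j < n) (if (i < j)%N then fd lam i j else 0).

(** The pair [i], [j] contributes 1. For [k] outside the interval from [i] to [j] the changes of its
    floors against [i] and [j] cancel; for [k] inside, regularity makes both changes equal in total
    to twice the gap. *)
Lemma floor_deg_refl lam i j : regular lam -> (i < j)%N ->
  floor_deg (refl r lam (root i j)) = floor_deg lam + 1 +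
    2 * \sum_(k < n | (i < k < j)%N) (fd lam i k + fd lam k j + 1 - fd lam i j).
Proof.
move=> reg ij; have ijF : i != j by rewrite neq_ltn ij.
have [] := refl_root_split lam ijF; set lam' := refl _ _ _ => li lj lk.
pose E (a b : 'I_n) : int := (if (a < b)%N then fd lam a b else 0) -
  (if (a < b)%N then fd lam' a b else 0).
suff H : \sum_a \sum_b E a b = 1 +
   2 * \sum_(k < n | (i < k < j)%N) (fd lam i k + fd lam k j + 1 - fd lam i j).
  rewrite -addrA -H (_ : \sum_a \sum_b E a b = floor_deg lam' - floor_deg lam).
    by rewrite addrC subrK.
  by rewrite /floor_deg opprK addrC -sumrB; apply: eq_bigr => a _; rewrite -sumrB.
rewrite (@sum_cross _ _ _ i j) //; last first.
  by move=> a b ai aj bi bj; rewrite /E !lk // subrr.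
(* The new floor at [i], [j] is [fd lam j i] plus twice [fd lam i j], that is [fd lam i j - 1] by
   regularity. *)
have -> : E i i + E i j + E j i + E j j = 1.
  rewrite /E !ltnn ij ltnNge ltnW //= li lj.
  rewrite (_ : _ - (lam 0 i - _) =
    lam 0 j - lam 0 i + r%:R * (fd lam i j + fd lam i j)%:~R); last by rewrite intrD; ring.
  by rewrite fdivDz // (fdC reg ijF); ring.
congr (_ + _); rewrite mulr_sumr big_mkcond [RHS]big_mkcond /=.
apply: eq_bigr => k _; case: eqVneq => [->|ki] /=; first by rewrite ltnn.
case: eqVneq => [->|kj] /=; first by rewrite ltnn andbF.
rewrite /E li lj lk //.
have -> : fdiv r (lam 0 k - (lam 0 j + r%:R * (fd lam i j)%:~R)) = fd lam k j - fd lam i j.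
  by rewrite opprD addrA fdivBz.
have -> : fdiv r (lam 0 k - (lam 0 i - r%:R * (fd lam i j)%:~R)) = fd lam k i + fd lam i j.
  by rewrite opprB addrCA addrC fdivDz // .
have -> : fdiv r (lam 0 j + r%:R * (fd lam i j)%:~R - lam 0 k) = fd lam j k + fd lam i j.
  by rewrite addrAC fdivDz.
have -> : fdiv r (lam 0 i - r%:R * (fd lam i j)%:~R - lam 0 k) = fd lam i k - fd lam i j.
  by rewrite addrAC fdivBz.
rewrite (fdC reg kj) (fdC (i:=i) (j:=k)) // 1?eq_sym //.
have ki' : (k : nat) != i by [].
have kj' : (k : nat) != j by [].
case: ltngtP ki' => // ki' _; case: ltngtP kj' => // kj' _ /=; try lia; ring.
Qed.

End Reflection.

(** * Coordinates and height in the root lattice *)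

Section RootLattice.
Variable n : nat.
Implicit Types (i j k : 'I_n) (c : nat -> int).

Lemma alpha_eps i j : i.+1 = j :> nat -> alpha n i = eps i - eps j.
Proof. by move=> ij; apply/rowP => k; rewrite !mxE -!val_eqE /= ij. Qed.

Lemma sum_alpha i j : (i <= j)%N -> \sum_(i <= t < j) alpha n t = eps i - eps j.
Proof.
(* [e] extends the basis to all natural indices, by zero from [n] on, so that the sum telescopes
   without bounds. *)
move=> ij; pose e m : 'rV[rat]_n := \row_k ((k : nat) == m)%:R.
rewrite -[LHS]opprK -sumrN (eq_bigr (fun t => e t.+1 - e t)).
  by rewrite telescope_sumr // opprB; apply/rowP => k; rewrite !mxE.
by move=> t _; apply/rowP => k; rewrite !mxE opprB.
Qed.

Lemma QeltD c c' : Qelt n (fun t => c t + c' t) = Qelt n c + Qelt n c'.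
Proof. by rewrite -big_split; apply: eq_bigr => t _; rewrite intrD scalerDl. Qed.

Lemma Qelt_root i j (e : int) : (i <= j)%N ->
  Qelt n (fun t => if (i <= t < j)%N then e else 0) = e%:~R *: (eps i - eps j).
Proof.
move=> ij; rewrite -sum_alpha // scaler_sumr.
rewrite (big_nat_widenl _ 0) // (big_nat_widen _ _ n.-1); last by have := ltn_ord j; lia.
rewrite /Qelt -(big_mkord xpredT
  (fun t => (if (i <= t < j)%N then e else 0)%:~R *: alpha n t)).
by rewrite [RHS]big_mkcond; apply: eq_bigr => t _; rewrite /=; case: ifP => //; rewrite scale0r.
Qed.

Lemma Qelt_int c : {g : 'I_n -> int | forall k, Qelt n c 0 k = (g k)%:~R}.
Proof.
exists (fun k => Num.floor (Qelt n c 0 k)) => k; rewrite floorK //.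
rewrite /Qelt summxE rpred_sum // => t _; rewrite !mxE.
by rewrite rpredM ?rpredB ?intr_int // natr_int.
Qed.

(** The left side is the pairing with the sum $2\rho$ of the positive roots. It is linear and equals
    2 on each simple root: the pair of adjacent indices gives 2, and any other index meets both with
    opposite signs. *)
Lemma sum_height c :
  \sum_(i < n) \sum_(j < n) (if (i < j)%N then Qelt n c 0 i - Qelt n c 0 j else 0)
  = (2 * Qheight n c)%:~R.
Proof.
pose S (v : 'rV[rat]_n) := \sum_(i < n) \sum_(j < n) (if (i < j)%N then v 0 i - v 0 j else 0).
have S_alpha (t : 'I_n.-1) : S (alpha n t) = 2.
  have [tn t1n] : (t < n /\ t.+1 < n)%N by have := ltn_ord t; lia.
  pose i := Ordinal tn; pose j := Ordinal t1n.
  have ij : i != j by rewrite -val_eqE /= ltn_eqF.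
  have ijC : (j == i) = false by rewrite eq_sym (negbTE ij).
  rewrite (alpha_eps (i := i) (j := j)) // /S (@sum_cross _ _ _ i j) //; last first.
    move=> a b /negbTE ai /negbTE aj /negbTE bi /negbTE bj.
    by rewrite !mxE ai aj bi bj; case: ifP.
  rewrite big1 => [|k /andP[/negbTE ki /negbTE kj]].
    have ij1 : (i < j)%N by rewrite /= ltnSn.
    have ij2 : (j < i)%N = false by rewrite ltnNge ltnW.
    by rewrite !ltnn ij1 ij2 !mxE !eqxx (negbTE ij) ijC.
  rewrite !mxE !eqxx (negbTE ij) ijC ki kj.
  have ki' : (k : nat) != t by apply/negbT.
  have kj' : (k : nat) != t.+1 by apply/negbT.
  by case: ltngtP ki' => //= kt _; case: ltngtP kj' => //= kt1 _; lia.
have S_Qelt : S (Qelt n c) = \sum_(t < n.-1) (c t)%:~R * S (alpha n t).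
  rewrite /S; under [RHS]eq_bigr do rewrite mulr_sumr.
  rewrite [RHS]exchange_big; apply: eq_bigr => i _.
  under [RHS]eq_bigr do rewrite mulr_sumr.
  rewrite [RHS]exchange_big; apply: eq_bigr => j _.
  case: ifP => _; last by rewrite big1 // => t _; rewrite mulr0.
  by rewrite /Qelt !summxE -sumrB; apply: eq_bigr => t _; rewrite mulrBr !mxE.
rewrite -/(S _) S_Qelt.
under eq_bigr do rewrite S_alpha.
by rewrite -mulr_suml /Qheight intrM mulrC rmorph_sum.
Qed.

End RootLattice.

(** Reindexing by [s] turns inversions of [s] into inversions of its inverse, the form in which they
    appear in the coordinates of [permact s Lam]. *)
Lemma perm_lengthE n (s : 'S_n) : (perm_length s)%:Z =
  \sum_(i < n) \sum_(j < n) (if (i < j)%N then ((s^-1 j < s^-1 i)%N)%g%:Z else 0).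
Proof.
rewrite /perm_length -sum1_card (big_morph Posz PoszD (erefl _)) big_mkcond /=.
rewrite [RHS]exchange_big /= [RHS](reindex_inj (@perm_inj _ s)) /=.
under [RHS]eq_bigr do rewrite (reindex_inj (@perm_inj _ s)) /=.
rewrite pair_bigA /=; apply: eq_bigr => p _.
by rewrite inE !permK; case: (p.1 < p.2)%N; case: ifP.
Qed.

(** * Degree, regularity and reflections on the orbit of $\Lambda$ *)

Section Orbit.
Variables (n r : nat) (Lam : 'rV[rat]_n).
Hypothesis r_gt0 : (0 < r)%N.
Hypothesis Lam_alcove : forall i j : 'I_n, (i < j)%N -> 0 < Lam 0 i - Lam 0 j < r%:R.
Implicit Types (lam : 'rV[rat]_n) (i j k : 'I_n).

Lemma fdiv_Lam i j : i != j -> fdiv r (Lam 0 i - Lam 0 j) = - (j < i)%N%:Z.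
Proof.
move=> ij; apply/eqP; rewrite fdiv_eq //; move: (ij); rewrite -val_eqE /=.
case: ltngtP => // h _ /=; have /andP[h1 h2] := Lam_alcove h.
  by rewrite addNr mulr0 mulrN1 subr_lt0 -subr_gt0 h1 andbT; lra.
by rewrite mulr0 add0r mulr1 ltW.
Qed.

(** For [i < j] the floor is [g i - g j] minus the inversion indicator of [s^-1]; summing gives the
    length by [perm_lengthE] and the height by [sum_height]. In particular the degree does not
    depend on the decomposition. *)
Lemma has_deg_floor_deg lam d : has_deg r Lam lam d -> d = floor_deg r lam.
Proof.
move=> [s [c [-> ->]]]; have [g gE] := Qelt_int n c.
have h : 2 * Qheight n c = \sum_(i < n) \sum_(j < n) (if (i < j)%N then g i - g j else 0).
  apply: (@intr_inj rat); rewrite -sum_height rmorph_sum; apply: eq_bigr => i _.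
  rewrite rmorph_sum; apply: eq_bigr => j _; rewrite !gE /=; case: ifP => // _.
  by rewrite rmorphB.
rewrite perm_lengthE h /floor_deg -opprB -sumrB; congr (- _); apply: eq_bigr => i _.
rewrite -sumrB; apply: eq_bigr => j _; case: ifP => [ij|]; last by rewrite subr0.
rewrite !mxE.
rewrite !gE (_ : _ + _ - _ = Lam 0 (s^-1 i)%g - Lam 0 (s^-1 j)%g + r%:R * (g i - g j)%:~R).
  rewrite fdivDz // fdiv_Lam 1?addrC //.
  by rewrite (inj_eq perm_inj) neq_ltn ij.
by rewrite intrB; ring.
Qed.

Lemma inWL_has_deg lam : inWL r Lam lam -> has_deg r Lam lam (floor_deg r lam).
Proof.
move=> [s [c E]]; have H : has_deg r Lam lam ((perm_length s)%:Z - 2 * Qheight n c).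
  by exists s, c.
by rewrite -(has_deg_floor_deg H).
Qed.

Lemma inWL_regular lam : inWL r Lam lam -> regular r lam.
Proof.
move=> [s [c ->]] i j e ij; have [g gE] := Qelt_int n c; apply/eqP.
rewrite !mxE !gE.
move=> h.
have ijs : (s^-1 i)%g != (s^-1 j)%g by rewrite (inj_eq perm_inj).
have {}h : Lam 0 (s^-1 i)%g - Lam 0 (s^-1 j)%g = 0 + r%:R * (e - g i + g j)%:~R.
  by rewrite !(intrD, intrB, intrN); move: h; lra.
have fdiv0 : fdiv r 0 = 0 by rewrite /fdiv mul0r floor0.
(* A congruence of two coordinates makes a difference of coordinates of [Lam] an exact multiple of
   [r]; its floor allows only 0 and [- r], and both violate the strict alcove bounds. *)
have e_eq : e - g i + g j = - ((s^-1 j)%g < (s^-1 i)%g)%N%:Z.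
  by rewrite -(fdiv_Lam ijs) h fdivDz // fdiv0 add0r.
move: h ijs; rewrite e_eq add0r -val_eqE /=.
case: ltngtP => // /Lam_alcove /andP[h1 h2] h _; move: h h1 h2; rewrite ?mulr0 ?mulrN1; lra.
Qed.

Lemma inWL_refl lam i j : inWL r Lam lam -> (i < j)%N ->
  inWL r Lam (refl r lam (eps i - eps j)).
Proof.
move=> [s [c E]] lij; have ij : i != j by rewrite neq_ltn lij.
have [g gE] := Qelt_int n c.
(* [m] solves [g i + m = g j + f], with [f] the floor at [i], [j]: both sides count the multiples of
   [r] in coordinate [i] of the reflected vector. *)
pose m := fdiv r (lam 0 i - lam 0 j) - (g i - g j).
exists (s * tperm i j)%g, (fun t => c t + (if (i <= t < j)%N then m else 0)).
rewrite QeltD Qelt_root ?(ltnW lij) //; apply/rowP => k.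
have lamE l : lam 0 l = Lam 0 (s^-1 l)%g + r%:R * (g l)%:~R by rewrite E !mxE -gE.
rewrite refl_rootE // !mxE gE invMg permM tpermV /m !intrB.
move: (fdiv _ _) => f; rewrite !lamE.
case: tpermP => [->|->|/eqP/negbTE-> /eqP/negbTE->] /=; last by ring.
  by rewrite eqxx (negbTE ij) /=; ring.
by rewrite eqxx eq_sym (negbTE ij) /=; ring.
Qed.

End Orbit.

(** The coordinates of [Lam] decrease strictly, so every difference is bounded by first minus last,
    which is the pairing with [theta]. *)
Lemma alcove_root n r (Lam : 'rV[rat]_n) :
  (forall i : nat, (i.+1 < n)%N -> 0 < dot Lam (alpha n i)) ->
  dot Lam (theta n) < r%:R ->
  forall i j : 'I_n, (i < j)%N -> 0 < Lam 0 i - Lam 0 j < r%:R.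
Proof.
move=> Lam_pos Lam_theta.
(* The conditional equality carries the weak and the strict inequality through one induction. *)
have decr d (i j : 'I_n) : (i + d)%N = j -> Lam 0 j <= Lam 0 i ?= iff (d == 0)%N.
  elim: d j => [|d IH] j; first by rewrite addn0 => /val_inj ->; exact/leif_refl.
  rewrite addnS => ij; have lt_n : (i + d < n)%N by have := ltn_ord j; lia.
  have := IH (Ordinal lt_n) erefl; have := Lam_pos (i + d)%N.
  rewrite ij ltn_ord => /(_ isT); rewrite (@alpha_eps _ (Ordinal lt_n) j) // dot_root subr_gt0.
  move=> h1 /leifP h2; apply/leifP => /=; by case: (d == 0)%N h2 => [/eqP <-|/(lt_trans h1)].
have decrS (i j : 'I_n) : (i < j)%N -> Lam 0 j < Lam 0 i.
  move=> ij; have /leifP := decr (j - i)%N i j (subnKC (ltnW ij)).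
  by rewrite subn_eq0 leqNgt ij.
have decrE (i j : 'I_n) : (i <= j)%N -> Lam 0 j <= Lam 0 i.
  by move=> ij; have [] := decr (j - i)%N i j (subnKC ij).
move=> i j ij; rewrite subr_gt0 decrS //=.
case: n => [|n] in Lam Lam_pos Lam_theta i j ij decr decrS decrE *; first by case: i ij.
apply: le_lt_trans Lam_theta.
rewrite /theta -(big_mkord xpredT) (_ : \sum_(_ <= _ < _) _ = eps ord0 - eps ord_max).
  by rewrite dot_root lerB ?decrE // -ltnS.
by rewrite -sum_alpha.
Qed.

Lemma dot_root_eq2 n (i j k l : 'I_n) : (i < j)%N -> (k < l)%N ->
  dot (eps i - eps j) (eps k - eps l) = 2 -> (i, j) = (k, l).
Proof.
move=> ij kl; rewrite dot_root !mxE.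
have /negbTE ij' : i != j by rewrite neq_ltn ij.
case: (eqVneq k i) => [->|_] /=; last first.
  by case: eqVneq => _; case: eqVneq => _; case: eqVneq => _ /= h; exfalso; lra.
rewrite ij'; case: (eqVneq l j) => [->|_] //=.
by case: eqVneq => _ /= h; exfalso; lra.
Qed.

(** * Floors, degree bounds and residues after one reflection *)

Section FloorsAfterReflection.
Variables (n r : nat) (lam : 'rV[rat]_n).
Hypothesis r_gt0 : (0 < r)%N.
Hypothesis lam_reg : regular r lam.
Implicit Types (i j k l p q s : 'I_n).
Local Notation root i j := (eps i - eps j).
Local Notation fd lam i j := (fdiv r (lam 0 i - lam 0 j)).

Lemma fd_refl i j : i != j -> fd (refl r lam (root i j)) i j = fd lam i j - 1.
Proof.
move=> ij; rewrite !refl_rootE // eqxx eq_sym (negbTE ij) eqxx.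
rewrite (_ : _ - _ = lam 0 j - lam 0 i + r%:R * (fd lam i j + fd lam i j)%:~R).
  by rewrite fdivDz // (fdC r_gt0 lam_reg ij); ring.
by rewrite intrD; ring.
Qed.

Lemma fd_refl_il i j k : i != j -> k != i -> k != j ->
  fd (refl r lam (root i j)) i k = fd lam j k + fd lam i j.
Proof.
move=> ij /negbTE ki /negbTE kj; rewrite !refl_rootE // eqxx ki kj.
by rewrite addrAC fdivDz.
Qed.

Lemma fd_refl_jl i j k : i != j -> k != i -> k != j ->
  fd (refl r lam (root i j)) j k = fd lam i k - fd lam i j.
Proof.
move=> ij /negbTE ki /negbTE kj; rewrite !refl_rootE // eqxx ki kj eq_sym (negbTE ij).
by rewrite addrAC fdivBz.
Qed.

Lemma fd_refl_ir i j k : i != j -> k != i -> k != j ->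
  fd (refl r lam (root i j)) k i = fd lam k j - fd lam i j.
Proof.
move=> ij /negbTE ki /negbTE kj; rewrite !refl_rootE // eqxx ki kj.
by rewrite opprD addrA fdivBz.
Qed.

Lemma fd_refl_jr i j k : i != j -> k != i -> k != j ->
  fd (refl r lam (root i j)) k j = fd lam k i + fd lam i j.
Proof.
move=> ij /negbTE ki /negbTE kj; rewrite !refl_rootE // eqxx ki kj eq_sym (negbTE ij).
by rewrite opprB addrCA addrC fdivDz.
Qed.

(** The fractional parts of the two quotients add up either to less than 1 or to at least 1. Without
    a carry, an intermediate [k] costs 2 in degree; with a carry it costs nothing. *)
Lemma fd_split i k j :
  fd lam i j = fd lam i k + fd lam k j \/ fd lam i j = fd lam i k + fd lam k j + 1.
Proof.
have := fdivD r_gt0 (lam 0 i - lam 0 k) (lam 0 k - lam 0 j).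
rewrite addrA subrK => /andP[]; move: (fd lam i j) (fd lam i k) (fd lam k j); lia.
Qed.

Lemma fd_gap_ge0 i k j : 0 <= fd lam i k + fd lam k j + 1 - fd lam i j.
Proof. by case: (fd_split i k j) => ->; rewrite ?subrr // addrAC subrr. Qed.

(** One intermediate index without carry already adds 2, and the other gaps are nonnegative. *)
Lemma floor_deg_refl_gap i j k : (i < k)%N -> (k < j)%N ->
  fd lam i j = fd lam i k + fd lam k j ->
  floor_deg r lam + 1 < floor_deg r (refl r lam (root i j)).
Proof.
move=> ik kj e; rewrite floor_deg_refl ?(ltn_trans ik) // ltrDl.
rewrite (bigD1 k) ?ik //= e [_ + 1]addrC addrK -e.
by rewrite mulr_gt0 // ltr_pwDl // sumr_ge0 // => t _; apply: fd_gap_ge0.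
Qed.

Lemma floor_deg_refl_ge i j : (i < j)%N ->
  floor_deg r lam + 1 <= floor_deg r (refl r lam (root i j)).
Proof.
move=> ij; rewrite floor_deg_refl // lerDl mulr_ge0 // sumr_ge0 // => t _.
exact: fd_gap_ge0.
Qed.

(** Forgetting multiples of [r] leaves a transposition of coordinates, so a path of reflections
    yields a product of transpositions. *)
Lemma refl_residue i j k : i != j ->
  exists e : int, refl r lam (root i j) 0 k = lam 0 (tperm i j k) + r%:R * e%:~R.
Proof.
move=> ij; rewrite refl_rootE //.
case: tpermP => [->|->|/eqP/negbTE-> /eqP/negbTE->]; last by exists 0; rewrite mulr0 addr0.
  by rewrite eqxx; eexists.
by rewrite eq_sym (negbTE ij) eqxx; exists (- fd lam i j); rewrite intrN mulrN.
Qed.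

(** Neither reflection changes the coordinates that determine the floor of the other. *)
Lemma refl_comm i j k l : i != j -> k != l -> i != k -> i != l -> j != k -> j != l ->
  refl r (refl r lam (root i j)) (root k l) = refl r (refl r lam (root k l)) (root i j).
Proof.
move=> /negbTE ij /negbTE kl /negbTE ik /negbTE il /negbTE jk /negbTE jl.
have E := (ij, kl, ik, il, jk, jl).
have {}E := (E, eq_sym k i, eq_sym l i, eq_sym k j, eq_sym l j, eq_sym j i, eq_sym l k).
apply/rowP => t; rewrite !refl_rootE ?E //.
case: (eqVneq t i) => [->|_]; rewrite ?E //.
case: (eqVneq t j) => [->|_]; rewrite ?E //.
Qed.

Lemma regular_refl i j : i != j -> regular r (refl r lam (root i j)).
Proof.
move=> ij k l e kl.
have [ek ->] := refl_residue k ij; have [el ->] := refl_residue l ij.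
have := lam_reg (i := tperm i j k) (j := tperm i j l) (e - ek + el).
rewrite (inj_eq perm_inj) kl => /(_ isT); apply: contra_neq.
by rewrite !(intrD, intrN) => h; move: h; lra.
Qed.

End FloorsAfterReflection.

(** * Two-step paths on three positions *)

Section ThreePositions.
Variables (n r : nat) (lam : 'rV[rat]_n) (p q s : 'I_n).
Hypotheses (r_gt0 : (0 < r)%N) (lam_reg : regular r lam).
Hypotheses (pq : (p < q)%N) (qs : (q < s)%N).
Local Notation root i j := (eps i - eps j).
Local Notation fd lam i j := (fdiv r (lam 0 i - lam 0 j)).

(** The alternatives are the two cases of [fd_split] at [p], [q], [s]. Each 3-cycle has one
    factorization with [root p s] first and one with it second; without carry the former overshoots,
    with carry the latter does, and the remaining two paths have the same target. *)
Lemma triple_paths :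
  let R2 i j k l := refl r (refl r lam (root i j)) (root k l) in
  let overshoot mu := floor_deg r mu + 1 < floor_deg r (refl r mu (root p s)) in
  [/\ R2 p q q s = R2 q s p s, R2 q s p q = R2 p q p s & overshoot lam] \/
  [/\ R2 p q q s = R2 p s p q, R2 q s p q = R2 p s q s,
      overshoot (refl r lam (root p q)) & overshoot (refl r lam (root q s))].
Proof.
have neq (i j : 'I_n) : (i < j)%N -> i != j /\ j != i.
  by move=> ij; rewrite [j == i]eq_sym !neq_ltn ij.
have [[pqN qpN] [qsN sqN]] := (neq _ _ pq, neq _ _ qs).
have [psN spN] := neq _ _ (ltn_trans pq qs).
have E := (negbTE pqN, negbTE qpN, negbTE qsN, negbTE sqN, negbTE psN, negbTE spN).
have fsq : fd lam s q = - fd lam q s - 1 by apply: fdC.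
have fqp : fd lam q p = - fd lam p q - 1 by apply: fdC.
have fAps : fd (refl r lam (root p q)) p s = fd lam q s + fd lam p q by apply: fd_refl_il.
have fAqs : fd (refl r lam (root p q)) q s = fd lam p s - fd lam p q by apply: fd_refl_jl.
have fApq : fd (refl r lam (root p q)) p q = fd lam p q - 1 by apply: fd_refl.
have fBpq : fd (refl r lam (root q s)) p q = fd lam p s - fd lam q s by apply: fd_refl_ir.
have fBps : fd (refl r lam (root q s)) p s = fd lam p q + fd lam q s by apply: fd_refl_jr.
have fBqs : fd (refl r lam (root q s)) q s = fd lam q s - 1 by apply: fd_refl.
have fCpq : fd (refl r lam (root p s)) p q = fd lam s q + fd lam p s by apply: fd_refl_il.
have fCqs : fd (refl r lam (root p s)) q s = fd lam q p + fd lam p s by apply: fd_refl_jr.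
have [Ap Aq At] := refl_root_split r lam pqN.
have [Bq Bs Bt] := refl_root_split r lam qsN.
have [Cp Cs Ct] := refl_root_split r lam psN.
have regA : regular r (refl r lam (root p q)) by apply: regular_refl.
have regB : regular r (refl r lam (root q s)) by apply: regular_refl.
move=> R2 overshoot.
have overC : fd lam p s = fd lam p q + fd lam q s -> overshoot lam.
  exact: floor_deg_refl_gap.
have eq3 (u v : 'rV[rat]_n) : u 0 p = v 0 p -> u 0 q = v 0 q -> u 0 s = v 0 s ->
    (forall t, t != p -> t != q -> t != s -> u 0 t = v 0 t) -> u = v.
  move=> ep eq_q es et; apply/rowP => t.
  have [->//|tp] := eqVneq t p; have [->//|tq] := eqVneq t q; have [->//|ts] := eqVneq t s.
  exact: et.
move: overC fAps fAqs fApq fBpq fBps fBqs fCpq fCqs Ap Aq At Bq Bs Bt Cp Cs Ct regA regB.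
rewrite {}/R2 {}/overshoot.
set A := refl r lam (root p q); set B := refl r lam (root q s); set C := refl r lam (root p s).
move=> overC fAps fAqs fApq fBpq fBps fBqs fCpq fCqs Ap Aq At Bq Bs Bt Cp Cs Ct regA regB.
have As : A 0 s = lam 0 s by apply: At.
have Bp : B 0 p = lam 0 p by apply: Bt.
have Cq : C 0 q = lam 0 q by apply: Ct.
(* From here the intermediate vectors enter only through their recorded coordinates, floors and
   regularity. *)
clearbody A B C.
have fl := (fAps, fAqs, fBpq, fBps, fCpq, fCqs, fsq, fqp).
have ev := (Ap, Aq, As, Bp, Bq, Bs, Cp, Cq, Cs).
have RE (mu : 'rV[rat]_n) i j t (ij : i != j) := refl_rootE r mu t ij.
have off (t : 'I_n) : t != p -> t != q -> t != s ->
    [/\ (t == p) = false, (t == q) = false, (t == s) = false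
     & [/\ A 0 t = lam 0 t, B 0 t = lam 0 t & C 0 t = lam 0 t]].
  by move=> tp tq ts; rewrite !(negbTE tp, negbTE tq, negbTE ts) At ?Bt ?Ct.
case: (fd_split lam r_gt0 p q s) => h; [left|right]; split.
- apply: eq3 => [|||t tp tq ts]; rewrite (RE A _ _ _ qsN) (RE B _ _ _ psN);
    rewrite ?E ?eqxx ?fl ?ev ?h; try by rewrite !(intrD, intrN); ring.
  by case: (off t) => // -> -> -> [-> -> _].
- apply: eq3 => [|||t tp tq ts]; rewrite (RE B _ _ _ pqN) (RE A _ _ _ psN);
    rewrite ?E ?eqxx ?fl ?ev ?h; try by rewrite !(intrD, intrN); ring.
  by case: (off t) => // -> -> -> [-> -> _].
- exact: overC.
- apply: eq3 => [|||t tp tq ts]; rewrite (RE A _ _ _ qsN) (RE C _ _ _ pqN);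
    rewrite ?E ?eqxx ?fl ?ev ?h; try by rewrite !(intrD, intrN); ring.
  by case: (off t) => // -> -> -> [-> _ ->].
- apply: eq3 => [|||t tp tq ts]; rewrite (RE B _ _ _ pqN) (RE C _ _ _ qsN);
    rewrite ?E ?eqxx ?fl ?ev ?h; try by rewrite !(intrD, intrN); ring.
  by case: (off t) => // -> -> -> [_ -> ->].
(* The first reflection removes the carry: the floors of [A] at [p], [q], [s] are additive, and
   likewise those of [B]. *)
- by apply: (floor_deg_refl_gap r_gt0 regA pq qs); rewrite fAps fAqs fApq h; ring.
- by apply: (floor_deg_refl_gap r_gt0 regB pq qs); rewrite fBps fBpq fBqs h; ring.
Qed.

End ThreePositions.

(** * Admissible two-step paths and their partners *)

Section TwoStepPaths.
Variables (n r : nat) (Lam lam : 'rV[rat]_n).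
Hypothesis r_gt0 : (0 < r)%N.
Hypothesis Lam_alcove : forall i j : 'I_n, (i < j)%N -> 0 < Lam 0 i - Lam 0 j < r%:R.
Hypothesis lam_orbit : inWL r Lam lam.
Implicit Types (i j k l p q s : 'I_n) (x : 'I_n * 'I_n) (u v : ('I_n * 'I_n) * ('I_n * 'I_n)).

(** A path is encoded by a pair of index pairs, first step first, so that roots correspond directly
    to transpositions. *)
Definition root_of x : 'rV[rat]_n := eps x.1 - eps x.2.
Definition ordered u := (u.1.1 < u.1.2)%N && (u.2.1 < u.2.2)%N.
Definition target u := refl r (refl r lam (root_of u.1)) (root_of u.2).
Definition adm2 u :=
  admissible r Lam lam (root_of u.1) /\
  admissible r Lam (refl r lam (root_of u.1)) (root_of u.2).

Lemma admissibleP mu i j : inWL r Lam mu -> (i < j)%N ->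
  admissible r Lam mu (root_of (i, j)) <->
  floor_deg r (refl r mu (root_of (i, j))) = floor_deg r mu + 1.
Proof.
move=> muW ij; have muW' := inWL_refl muW ij.
have degE := has_deg_floor_deg r_gt0 Lam_alcove.
split=> [[d [/degE -> /degE ->]] //|e].
exists (floor_deg r mu); rewrite -e.
by split; apply: inWL_has_deg.
Qed.

Lemma overshoot_inadmissible mu i j : inWL r Lam mu -> (i < j)%N ->
  floor_deg r mu + 1 < floor_deg r (refl r mu (root_of (i, j))) ->
  ~ admissible r Lam mu (root_of (i, j)).
Proof. by move=> muW ij /[swap] /(admissibleP muW ij) ->; rewrite ltxx. Qed.

(** Both paths raise the degree by 2 in total and each step raises it by at least 1, so every step
    raises it by exactly 1. *)
Lemma adm2_target u v : ordered u -> ordered v -> target u = target v -> adm2 u -> adm2 v.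
Proof.
case: u v => [[i j] [k l]] [[i' j'] [k' l']] /andP[/= ij kl] /andP[/= ij' kl'].
rewrite /target /adm2 /= => e [].
have W1 := inWL_refl lam_orbit ij.
have W1' := inWL_refl lam_orbit ij'.
move=> /(admissibleP lam_orbit ij) e1 /(admissibleP W1 kl) e2.
have reg := inWL_regular r_gt0 Lam_alcove lam_orbit.
have reg' := inWL_regular r_gt0 Lam_alcove W1'.
have g1 := floor_deg_refl_ge r_gt0 reg ij'.
have g2 := floor_deg_refl_ge r_gt0 reg' kl'.
move: e2 g1 g2; rewrite e e1 /root_of /= => e2 g1 g2.
suff /andP[/eqP d1 /eqP d2] :
    (floor_deg r (refl r lam (eps i' - eps j')) == floor_deg r lam + 1) &&
    (floor_deg r (refl r (refl r lam (eps i' - eps j')) (eps k' - eps l')) ==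
     floor_deg r (refl r lam (eps i' - eps j')) + 1).
  by split; [apply/(admissibleP lam_orbit ij')|apply/(admissibleP W1' kl')].
move: (floor_deg r lam) (floor_deg r (refl r lam _)) (floor_deg _ _) e2 g1 g2 => x y z.
lia.
Qed.

(** Modulo [r], each coordinate of the target is the coordinate of [lam] at the permuted index;
    regularity makes these residues distinct, so the target determines the product. *)
Lemma target_tperm i j k l i' j' k' l' :
  ordered ((i, j), (k, l)) -> ordered ((i', j'), (k', l')) ->
  target ((i, j), (k, l)) = target ((i', j'), (k', l')) ->
  forall t, tperm i j (tperm k l t) = tperm i' j' (tperm k' l' t).
Proof.
move=> /andP[/= ij kl] /andP[/= ij' kl'] e t.
have neq i0 j0 : (i0 < j0)%N -> i0 != j0 by move=> h; rewrite neq_ltn h.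
have [e1 E1] := refl_residue r (refl r lam (root_of (i, j))) t (neq _ _ kl).
have [e2 E2] := refl_residue r lam (tperm k l t) (neq _ _ ij).
have [e3 E3] := refl_residue r (refl r lam (root_of (i', j'))) t (neq _ _ kl').
have [e4 E4] := refl_residue r lam (tperm k' l' t) (neq _ _ ij').
have E : target ((i, j), (k, l)) 0 t = target ((i', j'), (k', l')) 0 t by rewrite e.
apply/eqP; apply: contraT => ne.
have /eqP[] := inWL_regular r_gt0 Lam_alcove lam_orbit (e4 + e3 - e2 - e1) ne.
move: E; rewrite /target E1 E3 /= E2 E4 !(intrD, intrN) => E.
lra.
Qed.

Definition has_unique_partner u := exists v,
  [/\ ordered v, v.1 <> u.1, adm2 v, target u = target v
    & forall w, ordered w -> w.1 <> u.1 -> adm2 w -> target u = target w -> w = v].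

(** When only [u] and [v] are admissible paths to the target, each is the partner of the other; the
    variable [w] covers both roles at once. *)
Lemma unique_partner2 u v w : ordered u -> ordered v -> u.1 <> v.1 -> target u = target v ->
  (forall w', ordered w' -> adm2 w' -> target u = target w' -> w' = u \/ w' = v) ->
  w = u \/ w = v -> adm2 w -> has_unique_partner w.
Proof.
move=> uo vo uv e only [->|->] wadm; [exists v|exists u]; split; rewrite //; try exact: nesym.
- exact: adm2_target wadm.
- by move=> w' w'o w'u w'adm /(only _ w'o w'adm) [w'E|//]; rewrite w'E in w'u.
- exact: adm2_target wadm.
- by move=> w' w'o w'u w'adm; rewrite -e => /(only _ w'o w'adm) [//|w'E]; rewrite w'E in w'u.
Qed.

Section ThreeCycles.
Variables p q s : 'I_n.
Hypotheses (pq : (p < q)%N) (qs : (q < s)%N).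
Let ps : (p < s)%N := ltn_trans pq qs.
Let pqN : p <> q. Proof. by move=> e; move: pq; rewrite e ltnn. Qed.
Let qsN : q <> s. Proof. by move=> e; move: qs; rewrite e ltnn. Qed.

Lemma target_dichotomy :
  [/\ target ((p, q), (q, s)) = target ((q, s), (p, s)),
      target ((q, s), (p, q)) = target ((p, q), (p, s)),
      ~ adm2 ((p, s), (p, q)) & ~ adm2 ((p, s), (q, s))] \/
  [/\ target ((p, q), (q, s)) = target ((p, s), (p, q)),
      target ((q, s), (p, q)) = target ((p, s), (q, s)),
      ~ adm2 ((p, q), (p, s)) & ~ adm2 ((q, s), (p, s))].
Proof.
have reg := inWL_regular r_gt0 Lam_alcove lam_orbit.
have Wpq := inWL_refl lam_orbit pq; have Wqs := inWL_refl lam_orbit qs.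
case: (triple_paths r_gt0 reg pq qs) => [[e1 e2 o]|[e1 e2 o1 o2]]; [left|right];
  (split; [exact: e1|exact: e2| | ]).
- by move=> [+ _]; exact: (overshoot_inadmissible lam_orbit ps o).
- by move=> [+ _]; exact: (overshoot_inadmissible lam_orbit ps o).
- by move=> [_]; exact: (overshoot_inadmissible Wpq ps o1).
- by move=> [_]; exact: (overshoot_inadmissible Wqs ps o2).
Qed.

Lemma unique_partner_cycle w :
  [\/ w = ((p, q), (q, s)), w = ((q, s), (p, s)) | w = ((p, s), (p, q))] ->
  adm2 w -> has_unique_partner w.
Proof.
move=> wE wadm.
have O1 : ordered ((p, q), (q, s)) by rewrite /ordered /= pq qs.
have O2 : ordered ((q, s), (p, s)) by rewrite /ordered /= ps qs.
have O3 : ordered ((p, s), (p, q)) by rewrite /ordered /= ps pq.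
have only w' : ordered w' -> target ((p, q), (q, s)) = target w' ->
    [\/ w' = ((p, q), (q, s)), w' = ((q, s), (p, s)) | w' = ((p, s), (p, q))].
  case: w' => [[i j] [k l]] w'o e; have [/= ij kl] := andP w'o.
  by case: (tperm_mul_cycle pq qs ij kl (target_tperm O1 w'o e)) => -[-> -> -> ->];
    [constructor 1|constructor 2|constructor 3].
(* The path in [O1] shares its target with that of [O2] or of [O3], according to the alternative;
   [no] excludes the third one. *)
case: target_dichotomy => [[e _ no _]|[e _ _ no]].
- apply: (unique_partner2 O1 O2 _ e _ _ wadm); first by move=> /= [/pqN].
  + by move=> w' w'o w'adm /(only _ w'o) [] w'E; rewrite w'E in w'adm *; auto.
  + by case: wE => w'E; rewrite w'E in wadm *; auto.
- apply: (unique_partner2 O1 O3 _ e _ _ wadm); first by move=> /= [/qsN].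
  + by move=> w' w'o w'adm /(only _ w'o) [] w'E; rewrite w'E in w'adm *; auto.
  + by case: wE => w'E; rewrite w'E in wadm *; auto.
Qed.

Lemma unique_partner_cycleV w :
  [\/ w = ((q, s), (p, q)), w = ((p, s), (q, s)) | w = ((p, q), (p, s))] ->
  adm2 w -> has_unique_partner w.
Proof.
move=> wE wadm.
have O1 : ordered ((q, s), (p, q)) by rewrite /ordered /= pq qs.
have O2 : ordered ((p, s), (q, s)) by rewrite /ordered /= ps qs.
have O3 : ordered ((p, q), (p, s)) by rewrite /ordered /= ps pq.
have only w' : ordered w' -> target ((q, s), (p, q)) = target w' ->
    [\/ w' = ((q, s), (p, q)), w' = ((p, s), (q, s)) | w' = ((p, q), (p, s))].
  case: w' => [[i j] [k l]] w'o e; have [/= ij kl] := andP w'o.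
  by case: (tperm_mul_cycleV pq qs ij kl (target_tperm O1 w'o e)) => -[-> -> -> ->];
    [constructor 1|constructor 2|constructor 3].
case: target_dichotomy => [[_ e _ no]|[_ e no _]].
- apply: (unique_partner2 O1 O3 _ e _ _ wadm); first by move=> /= [/esym/pqN].
  + by move=> w' w'o w'adm /(only _ w'o) [] w'E; rewrite w'E in w'adm *; auto.
  + by case: wE => w'E; rewrite w'E in wadm *; auto.
- apply: (unique_partner2 O1 O2 _ e _ _ wadm); first by move=> /= [/esym/pqN].
  + by move=> w' w'o w'adm /(only _ w'o) [] w'E; rewrite w'E in w'adm *; auto.
  + by case: wE => w'E; rewrite w'E in wadm *; auto.
Qed.

End ThreeCycles.

Lemma unique_partner_disjoint i j k l : (i < j)%N -> (k < l)%N ->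
  i != k -> i != l -> j != k -> j != l ->
  adm2 ((i, j), (k, l)) -> has_unique_partner ((i, j), (k, l)).
Proof.
move=> ij kl ik il jk jl.
have ijN : i != j by rewrite neq_ltn ij.
have klN : k != l by rewrite neq_ltn kl.
have O1 : ordered ((i, j), (k, l)) by rewrite /ordered /= ij kl.
have O2 : ordered ((k, l), (i, j)) by rewrite /ordered /= ij kl.
apply: (unique_partner2 O1 O2) => /=; last by left.
- by move=> [/eqP]; rewrite (negbTE ik).
- exact: refl_comm.
- move=> [[i' j'] [k' l']] w'o _ e; have [/= ij' kl'] := andP w'o.
  by case: (tperm_mul_disjoint ij kl ij' kl' ik il jk jl (target_tperm O1 w'o e))
    => -[-> -> -> ->]; [left|right].
Qed.

(** Distinct roots share at most one index. If they share one, sorting the three indices gives one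
    of the six paths on [p < q < s]; otherwise the reflections commute. *)
Lemma unique_partner u : ordered u -> u.1 <> u.2 -> adm2 u -> has_unique_partner u.
Proof.
case: u => [[i j] [k l]] /andP[/= ij kl] ne.
have [ik|ik] := eqVneq i k.
  subst k; have [jl|lj|/val_inj jl] := ltngtP j l; last by rewrite jl in ne.
  - by apply: (unique_partner_cycleV ij jl); constructor 3.
  - by apply: (unique_partner_cycle kl lj); constructor 3.
have [il|il] := eqVneq i l.
  by subst l; apply: (unique_partner_cycleV kl ij); constructor 1.
have [jk|jk] := eqVneq j k.
  by subst k; apply: (unique_partner_cycle ij kl); constructor 1.
have [jl|jl] := eqVneq j l; last exact: unique_partner_disjoint.
subst l; have [lt|lt|/val_inj e] := ltngtP i k; last by rewrite e eqxx in ik.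
- by apply: (unique_partner_cycleV lt kl); constructor 2.
- by apply: (unique_partner_cycle lt ij); constructor 2.
Qed.

(** If an index [k] lay strictly between, either there is no carry at [k] and the first step
    overshoots, or the first reflection removes the carry and the second step overshoots. *)
Lemma adm2_same_simple i j : (i < j)%N -> adm2 ((i, j), (i, j)) -> i.+1 = j :> nat.
Proof.
move=> ij [/= /(admissibleP lam_orbit ij) d1].
have W := inWL_refl lam_orbit ij.
move=> /(admissibleP W ij) d2; apply/eqP; rewrite eqn_leq ij leqNgt /=; apply/negP => lt.
have nj : (i.+1 < n)%N := ltn_trans lt (ltn_ord j).
pose k := Ordinal nj; have ik : (i < k)%N by rewrite /=.
have kj : (k < j)%N by [].
have reg := inWL_regular r_gt0 Lam_alcove lam_orbit.
have ijN : i != j by rewrite neq_ltn ij.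
have kiN : k != i by rewrite neq_ltn ik orbT.
have kjN : k != j by rewrite neq_ltn kj.
case: (fd_split lam r_gt0 i k j) => h.
  by have := floor_deg_refl_gap r_gt0 reg ik kj h; rewrite d1 ltxx.
have := floor_deg_refl_gap r_gt0 (regular_refl reg ijN) ik kj.
rewrite d2 ltxx fd_refl // fd_refl_il // fd_refl_jr //.
have ikN : i != k by rewrite eq_sym.
rewrite (fdC r_gt0 reg kjN) (fdC r_gt0 reg ikN) h.
suff e (x y : int) :
  x + y + 1 - 1 = - y - 1 + (x + y + 1) + (- x - 1 + (x + y + 1)) by move/(_ (e _ _)).
by ring.
Qed.

End TwoStepPaths.

(** * Passage from ordered index pairs back to roots *)

Theorem theorem4p4 (n r : nat) (Lam : 'rV[rat]_n) :
  (2 <= n)%N -> (n + 2 <= r)%N ->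
  inP Lam ->
  (forall i : nat, (i.+1 < n)%N -> 0 < dot Lam (alpha n i)) ->
  dot Lam (theta n) < r%:R ->
  forall lam a b : 'rV[rat]_n,
    inWL r Lam lam -> posroot a -> posroot b ->
    admissible r Lam lam a -> admissible r Lam (refl r lam a) b ->
    (dot a b = 2 -> a = b /\ simple_root a) /\
    (dot a b <> 2 ->
      exists a' b' : 'rV[rat]_n,
        posroot a' /\ posroot b' /\ a' <> a /\
        admissible r Lam lam a' /\ admissible r Lam (refl r lam a') b' /\
        refl r (refl r lam a) b = refl r (refl r lam a') b' /\
        (forall a'' b'' : 'rV[rat]_n,
              posroot a'' -> posroot b'' -> a'' <> a ->
              admissible r Lam lam a'' -> admissible r Lam (refl r lam a'') b'' ->
              refl r (refl r lam a) b = refl r (refl r lam a'') b'' ->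
              a'' = a' /\ b'' = b')).
Proof.
move=> _ r_gt _ Lam_pos Lam_theta lam a b lamW [i [j [ij ->]]] [k [l [kl ->]]] adm1 adm2'.
have r_gt0 : (0 < r)%N by lia.
have Lam_alcove := alcove_root Lam_pos Lam_theta.
have dot_root_self (x y : 'I_n) : (x < y)%N -> dot (eps x - eps y) (eps x - eps y) = 2.
  move=> xy; have xyN : (x == y) = false by apply: ltn_eqF.
  by rewrite dot_root !mxE !eqxx xyN eq_sym xyN.
split=> [/(dot_root_eq2 ij kl) [ik jl]|ne].
  subst k l; split=> //; have e := adm2_same_simple r_gt0 Lam_alcove lamW ij (conj adm1 adm2').
  by exists i; rewrite (alpha_eps e) e ltn_ord.
have [] := @unique_partner _ _ _ _ r_gt0 Lam_alcove lamW ((i, j), (k, l)).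
- by rewrite /ordered /= ij kl.
- by move=> /= [ik jl]; apply: ne; rewrite -ik -jl dot_root_self.
- by [].
move=> [[i' j'] [k' l']] [vo ne' [a1 a2] e uniq].
have [/= ij' kl'] := andP vo.
exists (root_of (i', j')), (root_of (k', l')).
split; first by exists i', j'.
split; first by exists k', l'.
split.
  (* Equal roots have inner product 2, which forces equal index pairs. *)
  by move=> h; apply: ne'; apply: dot_root_eq2 => //; rewrite -h; apply: dot_root_self.
do 3 (split; first by []).
move=> a'' b'' [x [y [xy ->]]] [z [t [zt ->]]] ne'' adm1'' adm2'' e''.
suff [-> -> -> ->//] : ((x, y), (z, t)) = ((i', j'), (k', l')).
apply: uniq.
- by rewrite /ordered /= xy zt.
- by move=> /= [hx hy]; apply: ne''; rewrite hx hy.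
- by split.
- exact: e''.
Qed.
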